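(* Let $m\ge1$ and $d>1$ be integers, $c_1$ a positive integer and $c_2,\dots,c_{m+1}$ non-negative integers with $c_1\ge dc_2$. Let $M=M_{c_1,\dots,c_{m+1},d}$ be the $m\times(m+d)$ integer matrix whose $j$-th column, for $j=1,\dots,d+1$, is $(c_1-(j-1)c_2,\,(j-1)c_3,\,(j-1)c_4,\dots,(j-1)c_{m+1})^T$, and whose $(d+i)$-th column, for $i=2,\dots,m$, is $c_1\mathbf e_i$ ($\mathbf e_i$ the $i$-th standard basis vector of $\mathbb Z^m$); assume every column of $M$ is nonzero. Then the toric ideal $I_M\subseteq K[x_1,\dots,x_{m+d}]$, which has height $d$, is a set-theoretic complete intersection.
   Context: $K$ is a field. For an integer matrix $M$ with columns $\mathbf a_i$ (each nonzero), the toric ideal $I_M$ is the kernel of $x_i\mapsto\mathbf t^{\mathbf a_i}\in K[t_1^{\pm1},\dots,t_m^{\pm1}]$. An ideal $I$ is a set-theoretic complete intersection if $I=\mathrm{rad}(g_1,\dots,g_h)$ for some polynomials $g_1,\dots,g_h$ with $h=\mathrm{ht}(I)$. *)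

(* Defs.v *)
From HB Require Import structures.
From mathcomp Require Import all_boot all_order all_algebra.
From mathcomp Require Import mpoly.
Set Implicit Arguments. Unset Strict Implicit. Unset Printing Implicit Defensive.
Import GRing.Theory Num.Theory.
Local Open Scope ring_scope.

Section Defs.
Variables (K : fieldType) (n : nat).
Local Notation P := {mpoly K[n]}.

(* Toric ideal of an integer matrix M (m rows, n columns): the kernel of
   x_j |-> t^{a_j} into the Laurent ring K[t_1^{+-1},...,t_m^{+-1}] = K[Z^m].
   The image of f = sum_u f_u x^u is sum_u f_u t^{M u}; it vanishes iff for
   every b in Z^m the sum of the f_u with M u = b is zero. *)
Definition toric_ideal (m : nat) (M : 'M[int]_(m, n)) : P -> Prop :=
  fun f => forall b : 'I_m -> int,
    \sum_(u <- msupp f | [forall i, \sum_(j < n) M i j * (u j)%:Z == b i])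
       f@_u = 0.

Definition is_ideal (I : P -> Prop) : Prop :=
  I 0 /\ (forall a b, I a -> I b -> I (a + b)) /\ (forall r a, I a -> I (r * a)).

Definition prime_ideal (I : P -> Prop) : Prop :=
  is_ideal I /\ ~ I 1 /\ (forall a b, I (a * b) -> I a \/ I b).

Definition prime_chain_to (Q0 : P -> Prop) (k : nat) : Prop :=
  exists Q : nat -> P -> Prop,
    (forall i, (i <= k)%N -> prime_ideal (Q i)) /\
    (forall i, (i < k)%N -> (forall f, Q i f -> Q i.+1 f) /\
                            exists f, Q i.+1 f /\ ~ Q i f) /\
    (forall f, Q k f <-> Q0 f).

Definition ideal_height (I : P -> Prop) (h : nat) : Prop :=
  (exists Q, prime_ideal Q /\ (forall f, I f -> Q f) /\ prime_chain_to Q h /\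
             (forall k, prime_chain_to Q k -> (k <= h)%N)) /\
  (forall Q, prime_ideal Q -> (forall f, I f -> Q f) -> prime_chain_to Q h).

Definition rad_gen (h : nat) (g : 'I_h -> P) : P -> Prop :=
  fun f => exists k : nat, exists r : 'I_h -> P, f ^+ k = \sum_(i < h) r i * g i.

Definition set_theoretic_complete_intersection (I : P -> Prop) : Prop :=
  exists h (g : 'I_h -> P), ideal_height I h /\ (forall f, I f <-> rad_gen g f).

End Defs.

(* The matrix M_{c_1,...,c_{m+1},d} (0-based indices; c is 1-based: c 1, ..., c m.+1).
   Column j <= d : (c1 - j c2, j c3, ..., j c_{m+1})^T ;
   column j > d  : c1 e_{j-d} (0-based row j - d). *)
Definition Mcd (m d : nat) (c : nat -> nat) : 'M[int]_(m, m + d) :=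
  \matrix_(r < m, j < m + d)
    if (j <= d)%N then
      (if r == 0%N :> nat then (c 1%N)%:Z - (j * c 2%N)%:Z else (j * c r.+2)%:Z)
    else (if r == (j - d)%N :> nat then (c 1%N)%:Z else 0).

(* Main.v *)
(** The toric ideal is the kernel of a monomial map into a polynomial ring,
    because [c_1 >= d c_2] makes the matrix nonnegative; so it is prime and it
    is generated by binomials.

    Height: along a strict inclusion [Q < Q'] of primes, a family that is
    linearly independent modulo [Q'] stays independent modulo [Q] after
    multiplication by powers of an element of [Q'] outside [Q].  Hence a chain
    of length [k] below [I] gives about [D^(m+k)] independent polynomials of
    degree [O(D)] in [m+d] variables, and [k <= d].  A chain of length [d] is
    obtained by specializing [x_1, ..., x_d] one after the other.

    Generators up to radical: the first [d+1] columns are in arithmetic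
    progression, so [x_0, ..., x_d] lie on a rational normal curve
    [x_j = x_0 t^j], which is cut out set-theoretically by [d-1] equations whose
    [i]-th one is [x_0 (x_(i+1) - t x_i)^i] on the curve.  Write
    [(c_1, c_2, c_(r+2)) = g (p, q, w_r)] with [g] the gcd.  The last equation is
    [x_0^(p - d q) (Y - x_0^q t^p)^d] with [Y = \prod y_r^(w_r)]: each term
    of its binomial expansion is a monomial in [x_0, ..., x_d, y] exactly because
    [d q <= p].  A radical ideal [J] contains [f] as soon as [f] belongs to
    [J : x_0^oo] and to [rad (J + (x_0))], and both are checked on
    binomials. *)

Require Import Defs.
From HB Require Import structures.
From mathcomp Require Import all_boot all_order all_algebra.
From mathcomp Require Import mpoly.
From mathcomp Require Import ring zify.
Set Implicit Arguments. Unset Strict Implicit. Unset Printing Implicit Defensive.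
Import GRing.Theory.
Local Open Scope ring_scope.

(** * Ideals up to radical and saturation *)

Section Ideals.
Variables (K : fieldType) (n : nat).
Local Notation P := {mpoly K[n]}.
Implicit Types (J : P -> Prop) (f g x : P).

Definition eqmod J f g := J (f - g).

Definition radical J f := exists k, J (f ^+ k).

Definition radical_closed J := forall f k, J (f ^+ k) -> J f.

Definition span_ideal h (g : 'I_h -> P) f :=
  exists r : 'I_h -> P, f = \sum_(i < h) r i * g i.

Definition add_principal J x f := exists2 a, J a & exists r, f = a + r * x.

Definition saturation J x f := exists s, J (x ^+ s * f).

Section Fixed.
Variable J : P -> Prop.
Hypothesis hJ : is_ideal J.

Lemma ideal0 : J 0. Proof. by case: hJ. Qed.

Lemma idealD f g : J f -> J g -> J (f + g).
Proof. by case: hJ => _ [+ _]; apply. Qed.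

Lemma idealMl r f : J f -> J (r * f).
Proof. by case: hJ => _ [_]; apply. Qed.

Lemma idealMr r f : J f -> J (f * r).
Proof. by rewrite mulrC; apply: idealMl. Qed.

Lemma idealN f : J f -> J (- f).
Proof. by move=> Jf; rewrite -mulN1r; apply: idealMl. Qed.

Lemma idealB f g : J f -> J g -> J (f - g).
Proof. by move=> Jf Jg; apply: idealD => //; apply: idealN. Qed.

Lemma ideal_sum (I : Type) (r : seq I) (Q : pred I) (F : I -> P) :
  (forall i, Q i -> J (F i)) -> J (\sum_(i <- r | Q i) F i).
Proof. by move=> JF; apply: (big_ind J); [exact: ideal0|exact: idealD|]. Qed.

Lemma idealX f k : (0 < k)%N -> J f -> J (f ^+ k).
Proof. by case: k => // k _ Jf; rewrite exprS; apply: idealMr. Qed.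

Lemma eqmod_refl f : eqmod J f f.
Proof. by rewrite /eqmod subrr; exact: ideal0. Qed.

Lemma eqmod_sym f g : eqmod J f g -> eqmod J g f.
Proof. by move=> /idealN; rewrite opprB. Qed.

Lemma eqmod_trans g f h : eqmod J f g -> eqmod J g h -> eqmod J f h.
Proof. by move=> fg /(idealD fg); rewrite addrA subrK. Qed.

Lemma eqmodM f f' g g' : eqmod J f f' -> eqmod J g g' -> eqmod J (f * g) (f' * g').
Proof.
move=> Jf Jg; rewrite /eqmod.
have -> : f * g - f' * g' = (f - f') * g + f' * (g - g') by ring.
by apply: idealD; [apply: idealMr|apply: idealMl].
Qed.

Lemma eqmodMl r f g : eqmod J f g -> eqmod J (r * f) (r * g).
Proof. exact/eqmodM/eqmod_refl. Qed.

Lemma eqmodMr r f g : eqmod J f g -> eqmod J (f * r) (g * r).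
Proof. by move=> Jf; apply: eqmodM => //; exact: eqmod_refl. Qed.

Lemma eqmodMn f g k : eqmod J f g -> eqmod J (f *+ k) (g *+ k).
Proof. by rewrite -mulr_natr -[g *+ k]mulr_natr; apply: eqmodMr. Qed.

Lemma eqmodX f g k : eqmod J f g -> eqmod J (f ^+ k) (g ^+ k).
Proof.
move=> Jfg; elim: k => [|k IHk]; first by rewrite !expr0; exact: eqmod_refl.
by rewrite !exprS; apply: eqmodM.
Qed.

Lemma eqmod_sum (I : Type) (r : seq I) (Q : pred I) (F G : I -> P) :
  (forall i, Q i -> eqmod J (F i) (G i)) ->
  eqmod J (\sum_(i <- r | Q i) F i) (\sum_(i <- r | Q i) G i).
Proof. by move=> JFG; rewrite /eqmod -sumrB; apply: ideal_sum. Qed.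

Lemma eqmod_prod (I : Type) (r : seq I) (Q : pred I) (F G : I -> P) :
  (forall i, Q i -> eqmod J (F i) (G i)) ->
  eqmod J (\prod_(i <- r | Q i) F i) (\prod_(i <- r | Q i) G i).
Proof.
by move=> JFG; apply: (big_ind2 (eqmod J)); [exact: eqmod_refl|move=> *; exact: eqmodM|].
Qed.

Lemma eqmod_mem f g : eqmod J f g -> J f <-> J g.
Proof.
move=> Jfg; split=> [Jf|/(idealD Jfg)]; last by rewrite subrK.
by have := idealB Jf Jfg; rewrite opprB addrC subrK.
Qed.

Lemma radical_ideal : is_ideal (radical J).
Proof.
split; first by exists 1%N; rewrite expr1; exact: ideal0.
split=> [a b [k Ja] [l Jb]|r a [k Ja]]; last first.
  by exists k; rewrite exprMn; apply: idealMl.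
exists (k + l)%N; rewrite exprDn; apply: ideal_sum => i _; rewrite -mulr_natr.
apply: idealMr; case: (leqP l i) => [li|il].
  by rewrite -(subnK li) exprD mulrA; apply: idealMl.
apply: idealMr; have -> : (k + l - i = (l - i) + k)%N by lia.
by rewrite exprD; apply: idealMl.
Qed.

Lemma radical_radical : radical_closed (radical J).
Proof. by move=> f k [l]; rewrite -exprM => Jf; exists (k * l)%N. Qed.

Lemma radical_sub f : J f -> radical J f.
Proof. by move=> Jf; exists 1%N. Qed.

Lemma saturation_ideal x : is_ideal (saturation J x).
Proof.
split; first by exists 0%N; rewrite mulr0; exact: ideal0.
split=> [a b [s Ja] [t Jb]|r a [s Ja]]; last first.
  by exists s; rewrite mulrCA; apply: idealMl.
exists (s + t)%N; rewrite mulrDr exprD; apply: idealD.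
  by rewrite mulrAC; apply: idealMr.
by rewrite -mulrA; apply: idealMl.
Qed.

Lemma saturation_sub x f : J f -> saturation J x f.
Proof. by move=> Jf; exists 0%N; rewrite mul1r. Qed.

Lemma saturation_cancel x f k : saturation J x (x ^+ k * f) -> saturation J x f.
Proof. by case=> s; rewrite mulrA -exprD => Jf; exists (s + k)%N. Qed.

Lemma saturation_radical x : radical_closed J -> radical_closed (saturation J x).
Proof.
move=> radJ f k [s Jf]; case: k Jf => [|k] Jf.
  by exists s; apply: idealMr; rewrite expr0 mulr1 in Jf.
exists s; apply: (radJ _ k.+1); rewrite exprMn -exprM.
by rewrite mulnS exprD mulrAC; apply: idealMr.
Qed.

Lemma add_principal_ideal x : is_ideal (add_principal J x).
Proof.
split; first by exists 0; [exact: ideal0|exists 0; rewrite mul0r addr0].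
split=> [_ _ [a Ja [r ->]] [b Jb [s ->]]|c _ [a Ja [r ->]]].
  by exists (a + b); [exact: idealD|exists (r + s); ring].
by exists (c * a); [exact: idealMl|exists (c * r); ring].
Qed.

Lemma add_principal_sub x f : J f -> add_principal J x f.
Proof. by move=> Jf; exists f => //; exists 0; rewrite mul0r addr0. Qed.

Lemma add_principal_gen x : add_principal J x x.
Proof. by exists 0; [exact: ideal0|exists 1; rewrite mul1r add0r]. Qed.

(** From [x ^+ s * f] in [J], the power [(x * f) ^+ s.+1] is in [J], hence so is [x * f].
    Multiplying [f ^+ k = a + r * x] by [f] then puts [f ^+ k.+1] in [J]. *)
Lemma mem_of_saturation_radical x f : radical_closed J ->
  saturation J x f -> radical (add_principal J x) f -> J f.
Proof.
move=> radJ [s Jsf] [k [a Ja [r fkE]]].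
have Jxf : J (x * f).
  apply: (radJ _ s.+1); rewrite exprMn exprS -mulrA; apply: idealMl.
  by rewrite exprS mulrA; apply: idealMr.
apply: (radJ _ k.+1); rewrite exprSr fkE mulrDl; apply: idealD.
  exact: idealMr.
by rewrite -mulrA; apply: idealMl.
Qed.

End Fixed.

Lemma span_idealP h (g : 'I_h -> P) : is_ideal (span_ideal g).
Proof.
split; first by exists (fun=> 0); rewrite big1 // => i _; rewrite mul0r.
split=> [_ _ [r ->] [s ->]|c _ [r ->]].
  by exists (fun i => r i + s i); rewrite -big_split; apply: eq_bigr => i _ /=; ring.
by exists (fun i => c * r i); rewrite mulr_sumr; apply: eq_bigr => i _ /=; ring.
Qed.

Lemma span_ideal_gen h (g : 'I_h -> P) i : span_ideal g (g i).
Proof.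
exists (fun j => (j == i)%:R); rewrite (bigD1 i) //= eqxx mul1r big1 ?addr0 //.
by move=> j /negPf ->; rewrite mul0r.
Qed.

Lemma prime_radical_closed J : prime_ideal J -> radical_closed J.
Proof.
move=> [_ [J1 JM]] f; elim=> [|k IHk]; first by rewrite expr0.
by rewrite exprS => /JM[].
Qed.

End Ideals.

(** * Kernels of monomial maps *)

Section MonomialMap.
Variables (K : fieldType) (n k : nat) (B : 'I_n -> 'X_{1..k}).

(** Exponent of the image of ['X_[u]] under [x_j |-> 'X_[B j]]; it plays the role of the product of
    the matrix with [u]. *)
Definition mdegree (u : 'X_{1..n}) : 'X_{1..k} := (\sum_(j < n) B j *+ u j)%MM.

Local Notation monmap := (mmap (@mpolyC k K) (fun j : 'I_n => 'X_[B j])).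

Definition monker (f : {mpoly K[n]}) := monmap f = 0.

Lemma monmapX u : monmap 'X_[u] = 'X_[mdegree u].
Proof.
by rewrite mmapX /mmap1 /mdegree -mprodXnE.
Qed.

Lemma monker_prime : prime_ideal monker.
Proof.
rewrite /monker; split; first split; first by rewrite mmap0.
  split=> [a b a0 b0|r a a0]; first by rewrite mmapD a0 b0 addr0.
  by rewrite rmorphM /= a0 mulr0.
split; first by rewrite rmorph1 => /eqP; rewrite oner_eq0.
by move=> a b; rewrite rmorphM /= => /eqP; rewrite mulf_eq0 => /orP[]/eqP; [left|right].
Qed.

Lemma mcoeff_monmap f w :
  (monmap f)@_w = \sum_(u <- msupp f | mdegree u == w) f@_u.
Proof.
rewrite /mmap raddf_sum [RHS]big_mkcond; apply: eq_bigr => u _ /=.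
have := monmapX u; rewrite mmapX => ->.
by rewrite mcoeffCM mcoeffX; case: eqP; rewrite ?mulr1 ?mulr0.
Qed.

Lemma monker_binomial u v : monker ('X_[u] - 'X_[v]) <-> mdegree u = mdegree v.
Proof.
rewrite /monker mmapB !monmapX; split=> [/eqP|->]; last by rewrite subrr.
rewrite subr_eq0 => /eqP/(congr1 (mcoeff (mdegree u))).
rewrite !mcoeffX eqxx; case: eqP => [->//|_] /eqP.
by rewrite oner_eq0.
Qed.

Lemma monker_fiber f :
  monker f <-> (forall w, \sum_(u <- msupp f | mdegree u == w) f@_u = 0).
Proof.
rewrite /monker; split=> [f0 w|f0]; first by rewrite -mcoeff_monmap f0 mcoeff0.
by apply/mpolyP => w; rewrite mcoeff_monmap f0 mcoeff0.
Qed.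

(** Each monomial of [f] is compared with a representative [rep] of its fiber chosen in the support.
    The coefficients of [f] add up to zero on every fiber, so the representatives cancel and [f] is
    a combination of binomials. *)
Lemma monker_sub (J : {mpoly K[n]} -> Prop) : is_ideal J ->
  (forall u v, mdegree u = mdegree v -> J ('X_[u] - 'X_[v])) ->
  forall f, monker f -> J f.
Proof.
move=> hJ hbin f /monker_fiber f0.
pose s := msupp f; pose W := undup (map mdegree s).
pose rep w := nth 0%MM s (index w (map mdegree s)).
have repE u : u \in s -> mdegree (rep (mdegree u)) = mdegree u.
  move=> us; have du : mdegree u \in map mdegree s by apply: map_f.
  rewrite -[LHS](nth_map _ (mdegree 0%MM)) ?nth_index //.
  by rewrite -(size_map mdegree) index_mem.
have -> : f = \sum_(u <- s) f@_u *: ('X_[u] - 'X_[rep (mdegree u)]).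
  under eq_bigr do rewrite scalerBr.
  rewrite sumrB -mpolyE; suff -> : \sum_(u <- s) f@_u *: 'X_[rep (mdegree u)] = 0 by rewrite subr0.
  transitivity (\sum_(u <- s) \sum_(w <- W | w == mdegree u) f@_u *: 'X_[K, rep w]).
    rewrite !big_seq; apply: eq_bigr => u us.
    rewrite -big_filter filter_pred1_uniq ?undup_uniq ?mem_undup ?map_f //.
    by rewrite big_seq1.
  rewrite (exchange_big_dep xpredT) //= big1 // => w _.
  rewrite -scaler_suml; under eq_bigl do rewrite eq_sym.
  by rewrite f0 scale0r.
rewrite big_seq; apply: ideal_sum => // u us.
by rewrite -mul_mpolyC; apply: idealMl => //; apply: hbin; rewrite repE.
Qed.

(** Both kernels depend only on how the monomials are partitioned into fibers. A value [b] or [w]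
    attained by no monomial of [f] gives an empty sum. *)
Lemma toric_monker m (M : 'M[int]_(m, n)) :
  (forall u v : 'X_{1..n}, mdegree u = mdegree v <->
     forall i, \sum_(j < n) M i j * (u j)%:Z = \sum_(j < n) M i j * (v j)%:Z) ->
  forall f, toric_ideal (K := K) M f <-> monker f.
Proof.
move=> hM f; rewrite monker_fiber.
have eqM (u v : 'X_{1..n}) :
    [forall i, \sum_(j < n) M i j * (u j)%:Z == \sum_(j < n) M i j * (v j)%:Z]
    = (mdegree u == mdegree v).
  by apply/forallP/eqP => [h|/hM h i]; [apply/hM => i; apply/eqP|apply/eqP].
split=> f0.
  move=> w; case: (altP (@hasP _ (fun v => mdegree v == w) (msupp f))).
    move=> [v vf /eqP <-]; rewrite -[RHS](f0 (fun i => \sum_(j < n) M i j * (v j)%:Z)).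
    by apply: eq_bigl => u; rewrite eqM.
  by move=> /hasPn no; rewrite big_seq_cond big1 // => u /andP[/no/negPf ->].
move=> b; pose Q (v : 'X_{1..n}) := [forall i, \sum_(j < n) M i j * (v j)%:Z == b i].
case: (altP (@hasP _ Q (msupp f))) => [[v vf /forallP hv]|/hasPn no].
  rewrite -[RHS](f0 (mdegree v)); apply: eq_bigl => u; rewrite -eqM.
  by apply: eq_forallb => i; rewrite (eqP (hv i)).
by rewrite big_seq_cond big1 // => u /andP[/no/negPf]; rewrite /Q => ->.
Qed.

End MonomialMap.

(** * Length of prime chains *)

Section Independence.
Variables (K : fieldType) (n : nat).
Local Notation P := {mpoly K[n]}.
Implicit Types (Q : P -> Prop) (T : finType).

Definition lin_indep_mod Q T (b : T -> P) :=
  forall a : T -> K, Q (\sum_t a t *: b t) -> forall t, a t = 0.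

(* The lowest nonzero coefficient of a relation [\sum_j G_j f^j] in [Q] lies in
   [Q'], since [f^j] can be cancelled modulo [Q]. *)
Lemma lin_indep_mod_extend Q Q' T (b : T -> P) (f : P) (D : nat) :
    prime_ideal Q -> is_ideal Q' -> (forall g, Q g -> Q' g) -> Q' f -> ~ Q f ->
  lin_indep_mod Q' b ->
  lin_indep_mod Q (fun t : T * 'I_D => b t.1 * f ^+ t.2).
Proof.
move=> primeQ hQ' QQ' Q'f Qf indep a.
pose G j := \sum_t a (t, j) *: b t.
have -> : \sum_t a t *: (b t.1 * f ^+ t.2) = \sum_(j < D) G j * f ^+ j.
  transitivity (\sum_t \sum_j a (t, j) *: (b t * f ^+ j)).
    by rewrite pair_bigA; apply: eq_bigr => -[].
  rewrite exchange_big /=.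
  by apply: eq_bigr => j _; rewrite mulr_suml; apply: eq_bigr => t _; rewrite scalerAl.
move=> Qsum [t j]; move: {2}(nat_of_ord j).+1 (ltnSn j) => l.
elim: l j t => // l IHl j t; rewrite ltnS leq_eqVlt => /orP[/eqP jl|]; last exact: IHl.
apply: (indep (fun t => a (t, j))); rewrite -/(G j).
(* The coefficients of index below [j] vanish by induction, so the whole sum is
   [f ^+ j * (G j + f * H)]. *)
pose H := \sum_(i < D | i != j) (if (i < j)%N then 0 else G i * f ^+ (i - j).-1).
have sumE : \sum_(i < D) G i * f ^+ i = f ^+ j * (G j + f * H).
  rewrite (bigD1 j) //= mulrDr [G j * _]mulrC; congr (_ + _).
  rewrite /H !mulr_sumr; apply: eq_bigr => i ij; case: (ltnP i j) => [lt_ij|le_ji].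
    rewrite [G i]big1 ?mul0r ?mulr0 // => t' _.
    by rewrite (IHl i t') ?scale0r // -jl.
  have lt_ji : (j < i)%N by rewrite ltn_neqAle le_ji andbT eq_sym.
  have -> : f ^+ i = f ^+ j * (f * f ^+ (i - j).-1).
    by rewrite -exprS prednK ?subn_gt0 // -exprD subnKC.
  by ring.
have QX : ~ Q (f ^+ j).
  by move/(prime_radical_closed primeQ).
move: Qsum; rewrite sumE => /primeQ.2.2[//|/QQ' Q'G].
have := idealB hQ' Q'G (idealMr hQ' H Q'f); by rewrite addrK.
Qed.

(** A polynomial of size at most [L] only involves monomials with all exponents below [L], and there
    are [L ^ n] of these. With more than [L ^ n] polynomials, the coefficient matrix [A] has a
    nonzero left kernel vector, which is a relation. *)
Lemma lin_indep_mod_card Q T (b : T -> P) (L : nat) :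
  Q 0 -> lin_indep_mod Q b -> (forall t, msize (b t) <= L)%N -> (#|T| <= L ^ n)%N.
Proof.
move=> Q0 indep sizeb; rewrite leqNgt; apply/negP => ltT.
pose E := {ffun 'I_n -> 'I_L}.
have cardE : #|{: E}| = (L ^ n)%N by rewrite card_ffun !card_ord.
pose mon (e : E) : 'X_{1..n} := [multinom (e i : nat) | i < n].
pose A := \matrix_(i < #|T|, e < #|{: E}|) (b (enum_val i))@_(mon (enum_val e)).
have : kermx A != 0.
  rewrite kermx_eq0 /row_free; apply: contraL ltT => /eqP rkA.
  by rewrite -leqNgt -rkA -cardE rank_leq_col.
case/rowV0Pn => v /sub_kermxP vA; apply/negP; rewrite negbK; apply/eqP/rowP => i.
rewrite mxE -[RHS](indep (fun t => v 0 (enum_rank t)) _ (enum_val i)) ?enum_valK //.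
suff -> : \sum_t v 0 (enum_rank t) *: b t = 0 by [].
apply/mpolyP => u; rewrite raddf_sum mcoeff0 /=.
under eq_bigr do rewrite mcoeffZ.
case: (leqP L (mdeg u)) => [leLu|ltuL].
  rewrite big1 // => t _; rewrite (memN_msupp_eq0 (msize_mdeg_ge _)) ?mulr0 //.
  exact: leq_trans leLu.
have ltu k : (u k < L)%N.
  apply: leq_ltn_trans ltuL; rewrite mdegE (bigD1 k) //=; exact: leq_addr.
pose e : E := [ffun k => Ordinal (ltu k)].
have monE : mon e = u by apply/mnmP => k; rewrite mnmE ffunE.
move/matrixP/(_ 0 (enum_rank e)): vA; rewrite !mxE => vA; rewrite -[RHS]vA.
rewrite (reindex (@enum_val T predT)) /=; last first.
  by exists enum_rank => x _; rewrite ?enum_valK ?enum_rankK.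
by apply: eq_bigr => k _; rewrite !mxE enum_valK enum_rankK monE.
Qed.

(** A growth condition that stands for the quotient by [Q] having dimension at least [m]. *)
Definition poly_indep_mod Q m := exists C, forall D, (0 < D)%N ->
  exists (T : finType) (b : T -> P),
    [/\ #|T| = (D ^ m)%N, forall t, (msize (b t) <= C * D)%N & lin_indep_mod Q b].

Lemma msizeX_le (f : P) j : (msize (f ^+ j) <= (j * (msize f).+1).+1)%N.
Proof.
elim: j => [|j IHj]; first by rewrite expr0 msize1.
by rewrite exprS (leq_trans (msizeM_le _ _)) // mulSn; lia.
Qed.

Lemma poly_indep_mod_leq Q m : Q 0 -> poly_indep_mod Q m -> (m <= n)%N.
Proof.
move=> Q0 [C hC]; rewrite leqNgt; apply/negP => ltnm.
(* With [D = (C ^ n).+1] and [n < m], [D ^ m >= D * D ^ n > C ^ n * D ^ n], which contradicts the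
   bound [(C * D) ^ n]. *)
have [T [b [cardT sizeb indep]]] := hC (C ^ n).+1 isT.
have := lin_indep_mod_card Q0 indep sizeb; rewrite cardT expnMn.
apply/negP; rewrite -ltnNge -(subnK ltnm) addnS expnS expnD.
apply: leq_trans (_ : (C ^ n).+1 * (C ^ n).+1 ^ n <= _)%N.
  by rewrite ltn_mul2r ltnSn andbT expn_gt0.
by rewrite leq_mul2l leq_pmull ?orbT // expn_gt0.
Qed.

(** Going down the chain from [Q], every strict inclusion raises the growth exponent by one; at the
    bottom it is [m + k], which cannot exceed [n]. *)
Lemma prime_chain_leq Q m k :
  prime_chain_to Q k -> poly_indep_mod Q m -> (m + k <= n)%N.
Proof.
move=> [R [primeR [strictR RkE]]] [C0 hC0].
suff indepR i : (i <= k)%N -> poly_indep_mod (R (k - i)%N) (m + i).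
  by apply: (poly_indep_mod_leq _ (indepR k _)); rewrite ?subnn //; case: (primeR 0%N) => // -[].
elim: i => [_|i IHi ltik].
  exists C0 => D /hC0[T [b [cardT sizeb indep]]]; exists T, b; split; rewrite ?addn0 //.
  by rewrite subn0 => a /RkE; apply: indep.
have [C hC] := IHi (ltnW ltik); have ltki : (k - i.+1 < k)%N by lia.
have [sub [f [Rf Nf]]] := strictR _ ltki.
have kiE : (k - i.+1).+1 = (k - i)%N by lia.
(* The factor [b t] has size at most [C * D], and [f ^+ j] with [j < D] has size at most
   [D * (msize f).+1]. *)
rewrite kiE in sub Rf; exists (C + msize f).+2 => D D_gt0.
have [T [b [cardT sizeb indep]]] := hC D D_gt0.
exists (T * 'I_D)%type, (fun t : T * 'I_D => b t.1 * f ^+ t.2); split.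
- by rewrite card_prod card_ord cardT addnS expnS mulnC.
- move=> [t j] /=; rewrite (leq_trans (msizeM_le _ _)) //.
  have := sizeb t; have := msizeX_le f j; have := ltn_ord j.
  have : (j.+1 * (msize f).+1 <= D * (msize f).+1)%N by rewrite leq_mul2r ltn_ord orbT.
  rewrite mulSn -!addSn !mulnDl; nia.
- apply: (lin_indep_mod_extend _ _ sub Rf Nf indep); first by apply: primeR; lia.
  by case: (primeR (k - i)%N); rewrite ?leq_subr.
Qed.

End Independence.

(** * The curve and torus equations *)

Section Equations.
Variables (K : fieldType) (n : nat).
Local Notation P := {mpoly K[n]}.
Variables (x : nat -> P) (Y : P) (d p q : nat).

(* Where [x_j = x_0 t^j] for [j <= i], this is [x_0 (x_(i+1) - t x_i)^i]. *)
Definition curve_eq i : P :=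
  \sum_(a < i.+1) ((-1) ^+ a * x i.+1 ^+ (i - a) * x i ^+ a * x a) *+ 'C(i, a).

(* The product of [D] of the variables [x_0, ..., x_d] whose indices add up to
   [W], provided that [W <= d * D]. *)
Definition weight_monomial D W : P :=
  if (W %/ d < D)%N then x d ^+ (W %/ d) * x (W %% d) * x 0%N ^+ (D - W %/ d).-1
  else x d ^+ D.

(* On the curve [x_j = x_0 t^j] this is [x_0^(p - d q) (Y - x_0^q t^p)^d]. *)
Definition torus_eq : P :=
  \sum_(k < d.+1) ((-1) ^+ k * Y ^+ (d - k)
                   * weight_monomial (p - (d - k) * q) (p * k)) *+ 'C(d, k).

Variable J : P -> Prop.
Hypotheses (hJ : is_ideal J) (radJ : radical_closed J).

(** * The equations when [x_0] can be cancelled *)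

Section Saturated.
Hypothesis satJ : forall f k, J (x 0%N ^+ k * f) -> J f.

Let satE f k : J (x 0%N ^+ k * f) <-> J f.
Proof. by split; [exact: satJ|exact: idealMl]. Qed.

Let radE f k : (0 < k)%N -> J (f ^+ k) <-> J f.
Proof. by move=> k0; split; [exact: radJ|exact: idealX]. Qed.

(** With [t = x_1 / x_0], denominators are cleared: modulo [J], [x_0^i] times the equation is
    [x_0 (x_0 x_(i+1) - x_1 x_i)^i], term by term. Saturation removes the powers of [x_0] and
    radicality the exponent [i]. *)
Lemma curve_eqE i : (0 < i)%N ->
    (forall a, (a <= i)%N -> eqmod J (x 0%N ^+ a * x a) (x 0%N * x 1%N ^+ a)) ->
  J (curve_eq i) <-> J (x 0%N * x i.+1 - x 1%N * x i).
Proof.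
move=> i0 Ex; rewrite -(radE (_ - _) i0) -(satE (_ ^+ i) 1) expr1 -(satE (curve_eq i) i).
apply: (eqmod_mem hJ); rewrite exprBn /curve_eq !mulr_sumr; apply: eqmod_sum => // a _.
have ai : (a <= i)%N by rewrite -ltnS.
rewrite !mulrnAr; apply: eqmodMn => //.
have -> : x 0%N ^+ i * ((-1) ^+ a * x i.+1 ^+ (i - a) * x i ^+ a * x a)
  = (x 0%N ^+ a * x a) * ((-1) ^+ a * (x 0%N * x i.+1) ^+ (i - a) * x i ^+ a).
  by rewrite exprMn -{1}(subnK ai) exprD; ring.
have -> : x 0%N * ((-1) ^+ a * (x 0%N * x i.+1) ^+ (i - a) * (x 1%N * x i) ^+ a)
  = (x 0%N * x 1%N ^+ a) * ((-1) ^+ a * (x 0%N * x i.+1) ^+ (i - a) * x i ^+ a).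
  by rewrite [(x 1%N * x i) ^+ a]exprMn; ring.
by apply: eqmodMr => //; apply: Ex.
Qed.

Hypothesis d_gt0 : (0 < d)%N.

(** Write [W = d b + r]. The [b] factors [x_d] and the factor [x_r] carry all the weight, and the
    remaining factors are [x_0]. If [b] reaches [D], the bound forces [W = d D]. *)
Lemma weight_monomialE D W : (W <= d * D)%N ->
    (forall j, (j <= d)%N -> eqmod J (x 0%N ^+ j * x j) (x 0%N * x 1%N ^+ j)) ->
  eqmod J (x 0%N ^+ W * weight_monomial D W) (x 0%N ^+ D * x 1%N ^+ W).
Proof.
move=> WdD Ex; rewrite /weight_monomial; case: ltnP => [ltWD|leDW].
  set b := (W %/ d)%N; set r := (W %% d)%N.
  have WE : W = (d * b + r)%N by rewrite {1}(divn_eq W d) mulnC.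
  have DE : D = (b + (D - b).-1.+1)%N by rewrite prednK ?subn_gt0 // subnKC // ltnW.
  have -> : x 0%N ^+ W * (x d ^+ b * x r * x 0%N ^+ (D - b).-1)
    = (x 0%N ^+ d * x d) ^+ b * (x 0%N ^+ r * x r) * x 0%N ^+ (D - b).-1.
    by rewrite {1}WE exprD exprM exprMn; ring.
  have -> : x 0%N ^+ D * x 1%N ^+ W
    = (x 0%N * x 1%N ^+ d) ^+ b * (x 0%N * x 1%N ^+ r) * x 0%N ^+ (D - b).-1.
    by rewrite {1}WE {1}DE !exprD exprS exprM exprMn; ring.
  apply: eqmodMr => //; apply: eqmodM => //; last by apply: Ex; rewrite ltnW ?ltn_mod.
  by apply: eqmodX => //; apply: Ex.
have -> : W = (d * D)%N.
  apply/eqP; rewrite eqn_leq WdD /=.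
  by rewrite mulnC (leq_trans (leq_mul leDW (leqnn d))) ?leq_divM.
rewrite !exprM -exprMn -[x 0%N ^+ D * _]exprMn; apply: eqmodX => //; exact: Ex.
Qed.

(** Modulo [J], [x_0^(p d)] times the equation is [x_0^(p - d q) (x_0^p Y - x_0^q x_1^p)^d];
    saturation and radicality do the rest. *)
Lemma torus_eqE : (d * q <= p)%N ->
    (forall j, (j <= d)%N -> eqmod J (x 0%N ^+ j * x j) (x 0%N * x 1%N ^+ j)) ->
  J torus_eq <-> J (x 0%N ^+ p * Y - x 0%N ^+ q * x 1%N ^+ p).
Proof.
move=> dqp Ex; rewrite -(radE (_ - _) d_gt0) -(satE (_ ^+ d) (p - d * q)) -(satE torus_eq (p * d)).
apply: (eqmod_mem hJ); rewrite exprBn /torus_eq !mulr_sumr; apply: eqmod_sum => // k _.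
have kd : (k <= d)%N by rewrite -ltnS.
have dE : d = ((d - k) + k)%N by rewrite subnK.
set D := (p - (d - k) * q)%N.
have DE : D = (p - d * q + q * k)%N by rewrite /D; nia.
(* This amounts to [(p - d q) k <= (p - d q) d]. *)
have WdD : (p * k <= d * D)%N by rewrite DE; nia.
rewrite !mulrnAr; apply: eqmodMn => //.
have -> : x 0%N ^+ (p * d) * ((-1) ^+ k * Y ^+ (d - k) * weight_monomial D (p * k))
  = (x 0%N ^+ (p * k) * weight_monomial D (p * k))
    * ((-1) ^+ k * (x 0%N ^+ p * Y) ^+ (d - k)).
  by rewrite {1}dE mulnDr exprD exprMn -exprM; ring.
have -> : x 0%N ^+ (p - d * q) *
      ((-1) ^+ k * (x 0%N ^+ p * Y) ^+ (d - k) * (x 0%N ^+ q * x 1%N ^+ p) ^+ k)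
  = (x 0%N ^+ D * x 1%N ^+ (p * k)) * ((-1) ^+ k * (x 0%N ^+ p * Y) ^+ (d - k)).
  by rewrite DE exprD [(x 0%N ^+ q * x 1%N ^+ p) ^+ k]exprMn !exprM; ring.
by apply: eqmodMr => //; apply: weight_monomialE.
Qed.

(** The relations for indices up to [i] turn the [i]-th equation into [x_0 x_(i+1) = x_1 x_i], which
    gives the relation for [i + 1]. *)
Lemma curve_param :
    (forall i, (0 < i < d)%N -> J (curve_eq i)) ->
  forall j, (j <= d)%N -> eqmod J (x 0%N ^+ j * x j) (x 0%N * x 1%N ^+ j).
Proof.
move=> JF; elim/ltn_ind => -[|[|i]] IH id.
- by rewrite expr0 mul1r mulr1; apply: eqmod_refl.
- by rewrite !expr1; apply: eqmod_refl.
have /curve_eqE : (0 < i.+1)%N by [].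
case=> [a ai|+ _]; first by apply: IH; lia.
move=> /(_ (JF i.+1 _)) Ji.
apply: (eqmod_trans hJ (g := x 0%N ^+ i.+1 * (x 1%N * x i.+1))).
  by rewrite exprSr -mulrA; apply: eqmodMl => //; apply: Ji; lia.
rewrite mulrCA [x 1%N ^+ i.+2]exprS [x 0%N * (_ * _)]mulrCA.
by apply: eqmodMl => //; apply: IH; lia.
Qed.

End Saturated.

(** Once [x_0, ..., x_i] are in [J], the only term left of [curve_eq i.+1] is [x_(i+1)^(i+2)] up to
    sign. *)
Lemma curve_eq_vanish :
    J (x 0%N) -> (forall i, (0 < i < d)%N -> J (curve_eq i)) ->
  forall j, (j < d)%N -> J (x j).
Proof.
move=> J0 JF; elim/ltn_ind => -[|i] IH id //.
have := JF i.+1 id; rewrite /curve_eq big_ord_recr /= => Ji.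
have Jlow : J (\sum_(a < i.+1)
    ((-1) ^+ a * x i.+2 ^+ (i.+1 - a) * x i.+1 ^+ a * x a) *+ 'C(i.+1, a)).
  apply: ideal_sum => // a _; rewrite -mulr_natr; apply: idealMr => //.
  by apply: idealMl => //; apply: IH => //; apply: ltn_trans id.
apply: (radJ (k := i.+2)); have := idealB hJ Ji Jlow.
rewrite [X in J X]addrC addKr subnn binn mulr1n mulr1 -mulrA -exprSr => Jx.
by have := idealMl hJ ((-1) ^+ i.+1) Jx; rewrite mulrA -exprMn mulrNN mulr1 expr1n mul1r.
Qed.

Hypothesis d_gt0 : (0 < d)%N.

(** Each term with [k < d] contains the variable of index [(p * k) %% d], which is in [J]; the term
    [k = d] is [x_d^p] up to sign. *)
Lemma torus_eq_vanish_lt : (d * q < p)%N ->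
  (forall j, (j < d)%N -> J (x j)) -> J torus_eq -> J (x d).
Proof.
move=> dqp Jx; rewrite /torus_eq big_ord_recr /= => JG.
have Jlow : J (\sum_(k < d) ((-1) ^+ k * Y ^+ (d - k)
                   * weight_monomial (p - (d - k) * q) (p * k)) *+ 'C(d, k)).
  apply: ideal_sum => // k _; rewrite -mulr_natr; apply: idealMr => //.
  apply: idealMl => //; rewrite /weight_monomial ifT.
    by apply: idealMr => //; apply: idealMl => //; apply: Jx; rewrite ltn_mod.
  have kd := ltn_ord k; rewrite ltn_divLR //.
  have -> : (p - (d - k) * q = (p - d * q) + k * q)%N by nia.
  (* The goal reduces to [(p - d q) k < (p - d q) d]; [l] and [e] make the two strict inequalities
     explicit. *)
  have [l dE] : exists l, d = (k + l.+1)%N by exists (d - k).-1; lia.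
  have [e pE] : exists e, p = (d * q + e.+1)%N by exists (p - d * q).-1; lia.
  rewrite [(p - _)%N](_ : _ = e.+1); last by lia.
  rewrite pE; nia.
apply: (radJ (k := p)); have := idealB hJ JG Jlow.
rewrite [X in J X]addrC addKr subnn binn mulr1n mulr1 mul0n subn0 /weight_monomial mulnK // ltnn.
move=> Jxd; have := idealMl hJ ((-1) ^+ d) Jxd.
by rewrite mulrA -exprMn mulrNN mulr1 expr1n mul1r.
Qed.

(** Here the [k]-th weight monomial is [x_d^(k q)], so the equation is exactly [(Y - x_d^q)^d]. *)
Lemma torus_eq_vanish_eq : (d * q)%N = p -> J torus_eq -> J (Y - x d ^+ q).
Proof.
move=> dqp JG; apply: (radJ (k := d)); rewrite exprBn; move: JG.
congr J; apply: eq_bigr => k _; congr (_ * _ *+ _).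
have kd : (k <= d)%N by rewrite -ltnS.
have -> : (p - (d - k) * q = k * q)%N by rewrite -dqp; nia.
by rewrite /weight_monomial -dqp -mulnA mulKn // [(k * q)%N]mulnC ltnn exprM.
Qed.

End Equations.

(** * Set-theoretic generation *)

Section CompleteIntersection.
Variables (K : fieldType) (m d p q k : nat) (w : nat -> nat).
Variable B : 'I_(m + d) -> 'X_{1..k}.
Local Notation P := {mpoly K[m + d]}.
Implicit Types (u v : 'X_{1..m + d}) (J : P -> Prop).

(** Under [x_j |-> x_0 t^j], the part of ['X_[u]] in [x_0, ..., x_d] has exponent [total_deg u] in
    [x_0] and [weight u] in [t]. *)
Definition total_deg u := (\sum_(j < m + d | j <= d) u j)%N.
Definition weight u := (\sum_(j < m + d | j <= d) j * u j)%N.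

Definition low_part u : P := \prod_(j < m + d | (j <= d)%N) 'X_j ^+ u j.
Definition high_part u : P := \prod_(j < m + d | ~~ (j <= d)%N) 'X_j ^+ u j.
Definition high_mono : P := \prod_(j < m + d | ~~ (j <= d)%N) 'X_j ^+ w (j - d).

Lemma mpolyX_low_high u : 'X_[u] = low_part u * high_part u.
Proof. by rewrite mpolyXE_id (bigID (fun j : 'I_(m + d) => (j <= d)%N)). Qed.

Lemma high_part_shift u v e :
    (forall j : 'I_(m + d), (d < j)%N -> u j = (v j + w (j - d) * e)%N) ->
  high_part u = high_mono ^+ e * high_part v.
Proof.
move=> uE; rewrite /high_part /high_mono -prodrXl -big_split; apply: eq_bigr => j /=.
by rewrite -ltnNge => dj; rewrite uE // exprD exprM mulrC.
Qed.

(** Equality of the degrees [p total_deg - q weight] and [w_r weight + p u_(d+r)], the first one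
    rearranged to avoid subtraction. *)
Definition congruent u v :=
  (p * total_deg u + q * weight v = p * total_deg v + q * weight u)%N /\
  forall j : 'I_(m + d), (d < j)%N ->
    (w (j - d) * weight u + p * u j = w (j - d) * weight v + p * v j)%N.

Lemma congruent_sym u v : congruent u v -> congruent v u.
Proof. by case=> Euv Hj; split=> [|j dj]; [lia|rewrite Hj]. Qed.

Hypotheses (d_gt1 : (1 < d)%N) (m_gt0 : (0 < m)%N) (p_gt0 : (0 < p)%N).
Hypothesis dqp : (d * q <= p)%N.
(** This says that [p], [q] and the [w_r] have greatest common divisor 1. *)
Hypothesis p_dvd : forall e, (p %| q * e)%N ->
  (forall r, (0 < r < m)%N -> (p %| w r * e)%N) -> (p %| e)%N.

Let md_gt0 : (0 < m + d)%N. Proof. by rewrite addn_gt0 m_gt0. Qed.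
Let x (j : nat) : P := 'X_(insubd (Ordinal md_gt0) j).
Let d_gt0 : (0 < d)%N. Proof. exact: ltnW. Qed.

Let xE (j : 'I_(m + d)) : x j = 'X_j. Proof. by rewrite /x valKd. Qed.

Let dmd : (d < m + d)%N. Proof. by rewrite -[X in (X < _)%N]add0n ltn_add2r. Qed.

(** On the invariants, [u] and [v] differ by [e] copies of the relation [x_0^p Y = x_0^q x_1^p].
    Coprimality makes [e] an integer, since [p] divides the weight difference times [q] and times
    each [w_r]. *)
Lemma congruent_shift u v : congruent u v -> (weight u <= weight v)%N ->
  exists e, [/\ weight v = (weight u + p * e)%N, total_deg v = (total_deg u + q * e)%N
    & forall j : 'I_(m + d), (d < j)%N -> u j = (v j + w (j - d) * e)%N].
Proof.
case=> E0 Ej /subnKC; set e := (weight v - weight u)%N => wtv.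
have /dvdnP[b eE] : (p %| e)%N.
  apply: p_dvd => [|r /andP[r0 rm]].
    apply/dvdnP; exists (total_deg v - total_deg u)%N.
    rewrite mulnBl; apply/eqP; rewrite -(eqn_add2l (p * total_deg u)).
    by rewrite -wtv in E0; apply/eqP; nia.
  have rmd : (d + r < m + d)%N by rewrite addnC ltn_add2r.
  have /= := Ej (Ordinal rmd); rewrite -[X in (X < _)%N]addn0 ltn_add2l r0 addKn => /(_ isT).
  rewrite -wtv => Er; apply/dvdnP; exists (u (Ordinal rmd) - v (Ordinal rmd))%N.
  by rewrite mulnBl; nia.
exists b; rewrite -wtv eE; split; first by rewrite mulnC.
  apply/eqP; rewrite -(eqn_pmul2l p_gt0); apply/eqP.
  by rewrite -wtv eE in E0; nia.
move=> j dj; apply/eqP; rewrite -(eqn_pmul2l p_gt0); apply/eqP.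
by have := Ej j dj; rewrite -wtv eE; nia.
Qed.

(** * Binomials when [x_0] can be cancelled *)

Section Saturated.
Variable J : P -> Prop.
Hypotheses (hJ : is_ideal J) (satJ : forall f l, J (x 0%N ^+ l * f) -> J f).

Lemma low_part_param u :
    (forall j, (j <= d)%N -> eqmod J (x 0%N ^+ j * x j) (x 0%N * x 1%N ^+ j)) ->
  eqmod J (x 0%N ^+ weight u * low_part u) (x 0%N ^+ total_deg u * x 1%N ^+ weight u).
Proof.
move=> Ex; rewrite /weight /total_deg /low_part !expr_sum -!big_split /=.
apply: eqmod_prod => // j jd.
by rewrite !exprM -!exprMn -xE; apply: eqmodX => //; apply: Ex.
Qed.

(** After multiplication by [x_0 ^+ weight v], the low parts become monomials in [x_0] and [x_1],
    and the surplus [Y^e] in [u] is exchanged for [(x_0^q x_1^p)^e]. *)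
Lemma binomial_saturated u v :
    (forall j, (j <= d)%N -> eqmod J (x 0%N ^+ j * x j) (x 0%N * x 1%N ^+ j)) ->
    J (x 0%N ^+ p * high_mono - x 0%N ^+ q * x 1%N ^+ p) ->
  congruent u v -> J ('X_[u] - 'X_[v]).
Proof.
move=> Ex JY; wlog le_uv : u v / (weight u <= weight v)%N => [hw|] uv.
  case: (leqP (weight u) (weight v)) => [|/ltnW] le_uv; first exact: hw.
  by apply: eqmod_sym => //; apply: hw => //; apply: congruent_sym.
have [e [wtE totE highE]] := congruent_shift uv le_uv.
apply: (satJ (l := weight v)); rewrite mulrBr !mpolyX_low_high (high_part_shift highE).
apply: (eqmod_trans hJ (g := x 0%N ^+ total_deg u * x 1%N ^+ weight u
                              * (x 0%N ^+ p * high_mono) ^+ e * high_part v)).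
  have -> : x 0%N ^+ weight v * (low_part u * (high_mono ^+ e * high_part v))
    = x 0%N ^+ weight u * low_part u * ((x 0%N ^+ p * high_mono) ^+ e * high_part v).
    by rewrite wtE exprD exprM [(_ * high_mono) ^+ e]exprMn; ring.
  by rewrite -[X in eqmod _ _ X]mulrA; apply: eqmodMr => //; apply: low_part_param.
apply: (eqmod_trans hJ (g := x 0%N ^+ total_deg u * x 1%N ^+ weight u
                              * (x 0%N ^+ q * x 1%N ^+ p) ^+ e * high_part v)).
  by apply: eqmodMr => //; apply: eqmodMl => //; apply: eqmodX.
have -> : x 0%N ^+ total_deg u * x 1%N ^+ weight u * (x 0%N ^+ q * x 1%N ^+ p) ^+ e
    = x 0%N ^+ total_deg v * x 1%N ^+ weight v.
  by rewrite totE wtE !exprD !exprM [(_ * _) ^+ e]exprMn; ring.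
apply: (eqmod_sym hJ); rewrite mulrA; apply: eqmodMr => //; exact: low_part_param.
Qed.

End Saturated.

(** * Binomials when [x_0] vanishes *)

Section Vanishing.
Variable J : P -> Prop.
Hypothesis hJ : is_ideal J.

Lemma mpolyX_mem u (j : 'I_(m + d)) : (0 < u j)%N -> J 'X_j -> J 'X_[u].
Proof.
move=> uj Jj; rewrite mpolyXE_id (bigD1 j) //=; apply: idealMr => //.
exact: idealX.
Qed.

(** The invariant [p total_deg - q weight]. Its coefficients are positive for [j < d], and the one
    for [j = d] is zero exactly when [d q = p]. *)
Let face u := (\sum_(j < m + d | j <= d) (p - j * q) * u j)%N.

Let faceE u : (p * total_deg u = face u + q * weight u)%N.
Proof.
rewrite /total_deg /face /weight !big_distrr -big_split; apply: eq_bigr => j jd /=.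
have : (j * q <= p)%N by apply: leq_trans dqp; rewrite leq_mul2r jd orbT.
move=> jqp; rewrite -{1}(subnK jqp) mulnDl; congr addn; lia.
Qed.

Lemma low_part_top u : (forall j : 'I_(m + d), (j < d)%N -> u j = 0%N) ->
  low_part u = x d ^+ total_deg u /\ weight u = (d * total_deg u)%N.
Proof.
move=> u0; pose jd : 'I_(m + d) := Ordinal dmd.
have Q (j : 'I_(m + d)) : (j <= d)%N && (j != jd) -> (j < d)%N.
  by rewrite ltn_neqAle andbC => /andP[-> ->].
have -> : total_deg u = u jd.
  by rewrite /total_deg (bigD1 jd) //= big1 ?addn0 // => j /Q/u0.
have -> : weight u = (d * u jd)%N.
  by rewrite /weight (bigD1 jd) //= big1 ?addn0 // => j /Q/u0->; rewrite muln0.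
split=> //; rewrite /low_part (bigD1 jd) //= -(xE jd).
by rewrite big1 ?mulr1 // => j /Q/u0->; rewrite expr0.
Qed.

(** If [face] is positive, both monomials contain a variable of [J]. If it is zero, [x_d] is the
    only low variable that can occur: for [d q = p] the monomials differ by replacing [Y] with
    [x_d^q], and for [d q < p] no low variable occurs, so they are equal. *)
Lemma binomial_vanishing u v :
    (forall j, (j < d)%N -> J (x j)) ->
    ((d * q < p)%N -> J (x d)) ->
    ((d * q)%N = p -> J (high_mono - x d ^+ q)) ->
  congruent u v -> J ('X_[u] - 'X_[v]).
Proof.
move=> Jx Jxd JY; wlog le_uv : u v / (weight u <= weight v)%N => [hw|] uv.
  case: (leqP (weight u) (weight v)) => [|/ltnW] le_uv; first exact: hw.
  by apply: eqmod_sym => //; apply: hw => //; apply: congruent_sym.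
have [e [wtE totE highE]] := congruent_shift uv le_uv.
have face_uv : face u = face v by have := uv.1; have := faceE u; have := faceE v; lia.
have face_mem u' : (0 < face u')%N -> J 'X_[u'].
  rewrite lt0n sum_nat_eq0 => /forall_inPn[j jd].
  rewrite muln_eq0 negb_or subn_eq0 -ltnNge -lt0n => /andP[jqp uj].
  apply: (mpolyX_mem uj); rewrite -xE.
  move: (jd : (j <= d)%N); rewrite leq_eqVlt => /orP[/eqP jdE|].
    by rewrite jdE; apply: Jxd; rewrite -[X in (X * _)%N]jdE.
  exact: Jx.
have [face0|face_gt0] := posnP (face u); last first.
  by apply: idealB => //; apply: face_mem; rewrite -?face_uv.
have top u' : face u' = 0%N -> forall j : 'I_(m + d), (j < d)%N -> u' j = 0%N.
  move/eqP; rewrite sum_nat_eq0 => /forall_inP h j jd.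
  have := h j (ltnW jd); rewrite muln_eq0 subn_eq0 => /orP[|/eqP//].
  have : (j.+1 * q <= d * q)%N by rewrite leq_mul2r jd orbT.
  by move: dqp p_gt0; case: (posnP q) => [-> | ]; nia.
have [lowu wtu] := low_part_top (top _ face0).
have [lowv wtv] := low_part_top (top _ (etrans (esym face_uv) face0)).
rewrite !mpolyX_low_high (high_part_shift highE) lowu lowv totE exprD exprM -mulrA.
apply: eqmodMl => //; apply: eqmodMr => //.
move: dqp; rewrite leq_eqVlt => /orP[/eqP/JY JY'|ltp]; first exact: eqmodX.
suff -> : e = 0%N by exact: eqmod_refl.
have tot0 : total_deg v = 0%N.
  have := faceE v; rewrite -face_uv face0 wtv.
  by case: (total_deg v) => // t; nia.
by move: wtE; rewrite wtv tot0 muln0; nia.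
Qed.

End Vanishing.

(** * The kernel as the radical of [d] equations *)

Hypothesis hB : forall u v, mdegree B u = mdegree B v <-> congruent u v.
Local Notation I := (monker (K := K) B).

Let hI : is_ideal I. Proof. by case: (monker_prime K B). Qed.
Let radI : radical_closed I. Proof. exact: (prime_radical_closed (monker_prime K B)). Qed.

Let satI f l : I (x 0%N ^+ l * f) -> I f.
Proof.
elim: l => [|l IHl]; first by rewrite mul1r.
rewrite exprS -mulrA => /(monker_prime K B).2.2[]//.
rewrite /monker monmapX => /(congr1 (mcoeff (mdegree B U_(insubd (Ordinal md_gt0) 0%N)))).
by rewrite mcoeffX eqxx mcoeff0 => /eqP; rewrite oner_eq0.
Qed.

Let ordx j : (j <= d)%N -> insubd (Ordinal md_gt0) j = j :> nat.
Proof. by move=> jd; rewrite val_insubd (leq_ltn_trans jd dmd). Qed.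

Let total_degD u v : total_deg (u + v) = (total_deg u + total_deg v)%N.
Proof. by rewrite /total_deg -big_split; apply: eq_bigr => j _; rewrite mnmDE. Qed.

Let weightD u v : weight (u + v) = (weight u + weight v)%N.
Proof. by rewrite /weight -big_split; apply: eq_bigr => j _ /=; rewrite mnmDE mulnDr. Qed.

Let total_degX j l : (j <= d)%N -> total_deg (U_(insubd (Ordinal md_gt0) j) *+ l) = l.
Proof.
move=> jd; rewrite /total_deg (bigD1 (insubd (Ordinal md_gt0) j)) ?ordx //=.
rewrite mulmnE mnm1E eqxx mul1n big1 ?addn0 // => i /andP[_ /negPf ij].
by rewrite mulmnE mnm1E eq_sym ij.
Qed.

Let weightX j l : (j <= d)%N -> weight (U_(insubd (Ordinal md_gt0) j) *+ l) = (j * l)%N.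
Proof.
move=> jd; rewrite /weight (bigD1 (insubd (Ordinal md_gt0) j)) ?ordx //=.
rewrite mulmnE mnm1E eqxx mul1n big1 ?addn0 // => i /andP[_ /negPf ij].
by rewrite mulmnE mnm1E eq_sym ij muln0.
Qed.

Let highX j l (i : 'I_(m + d)) : (j <= d)%N -> (d < i)%N ->
  (U_(insubd (Ordinal md_gt0) j) *+ l)%MM i = 0%N.
Proof.
move=> jd di; rewrite mulmnE mnm1E; case: eqP => // ji.
by move: di; rewrite -ji ordx // ltnNge jd.
Qed.

Let mem_param j : (j <= d)%N -> eqmod I (x 0%N ^+ j * x j) (x 0%N * x 1%N ^+ j).
Proof.
move=> jd; rewrite -[x j]expr1 -{2}[x 0%N]expr1 /x !mpolyXn -!mpolyXD.
apply/monker_binomial/hB; split=> [|i di]; rewrite ?total_degD ?weightD.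
  by rewrite !total_degX ?weightX //; lia.
by rewrite !mnmDE !weightX ?highX //; lia.
Qed.

Let mem_torus : I (x 0%N ^+ p * high_mono - x 0%N ^+ q * x 1%N ^+ p).
Proof.
pose yw : 'X_{1..m + d} := [multinom (if (j <= d)%N then 0 else w (j - d))%N | j < m + d].
have -> : high_mono = 'X_[yw].
  rewrite mpolyX_low_high [low_part _]big1 ?mul1r; last first.
    by move=> j jd; rewrite mnmE jd.
  by rewrite /high_mono; apply: eq_bigr => j /negPf jd; rewrite mnmE jd.
have tot0 : total_deg yw = 0%N by rewrite /total_deg big1 // => j jd; rewrite mnmE jd.
have wt0 : weight yw = 0%N by rewrite /weight big1 // => j jd; rewrite mnmE jd muln0.
rewrite /x !mpolyXn -!mpolyXD.
apply/monker_binomial/hB; split=> [|i di]; rewrite ?total_degD ?weightD ?tot0 ?wt0.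
  by rewrite !total_degX ?weightX //; lia.
by rewrite !mnmDE !weightX ?highX // mnmE leqNgt di /=; lia.
Qed.

Lemma monker_set_theoretic :
  exists g : 'I_d -> P, forall f, I f <-> rad_gen g f.
Proof.
pose Y := high_mono.
(* Indices [0, ..., d - 2] give the curve equations [1, ..., d - 1], and the last index gives the
   torus equation. *)
pose g (i : 'I_d) := if (i.+1 < d)%N then curve_eq x i.+1 else torus_eq x Y d p q.
pose J := radical (span_ideal g).
have hJ : is_ideal J by apply/radical_ideal/span_idealP.
have radJ : radical_closed J by apply: radical_radical.
have JF i : (0 < i < d)%N -> J (curve_eq x i).
  case: i => // i /= id; apply: radical_sub.
  by have := span_ideal_gen g (Ordinal (ltnW id)); rewrite /g /= id.
have JG : J (torus_eq x Y d p q).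
  have dd : (d.-1 < d)%N by rewrite prednK.
  apply: radical_sub; have := span_ideal_gen g (Ordinal dd).
  by rewrite /g /= prednK // ltnn.
exists g => f; split; last first.
  case=> l [r fl]; apply: (radI (k := l)); rewrite fl; apply: ideal_sum => // i _.
  apply: idealMl => //; rewrite /g; case: ltnP => id; last first.
    by apply/torus_eqE => //; apply: mem_param.
  apply/curve_eqE => // [a ai|]; first by apply: mem_param; lia.
  have := mem_param id; rewrite exprSr -mulrA [x 1%N ^+ _]exprS.
  rewrite [x 0%N * (x 1%N * _)]mulrCA => Ei; apply: (satI (l := i.+1)).
  rewrite mulrBr; apply: (eqmod_trans hI Ei); apply: (eqmod_sym hI).
  rewrite [x 0%N ^+ _ * _]mulrCA; apply: eqmodMl => //; apply: mem_param; exact: ltnW.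
suff IJ : forall h, I h -> J h by exact: IJ.
apply: (monker_sub hJ) => u v /hB uv.
apply: (mem_of_saturation_radical hJ (x := x 0%N)) => //.
  (* First condition: the binomial lies in the saturation, where [x_0] can be cancelled. *)
  pose S := saturation J (x 0%N).
  have hS : is_ideal S by apply: saturation_ideal.
  have radS : radical_closed S by apply: saturation_radical.
  have satS h l : S (x 0%N ^+ l * h) -> S h by apply: saturation_cancel.
  have Ex : forall j, (j <= d)%N -> eqmod S (x 0%N ^+ j * x j) (x 0%N * x 1%N ^+ j).
    by apply: curve_param => // i /JF; apply: saturation_sub.
  apply: (binomial_saturated hS satS Ex) => //.
  apply: (torus_eqE Y hS radS satS d_gt0 dqp Ex).1; exact: saturation_sub.
have hA := add_principal_ideal hJ (x 0%N).
(* Second condition: the binomial lies in the radical after adding [x_0], which forces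
   [x_0, ..., x_(d-1)] into [S]. *)
pose S := radical (add_principal J (x 0%N)).
have hS : is_ideal S by apply: radical_ideal.
have radS : radical_closed S by apply: radical_radical.
have JS h : J h -> S h by move=> Jh; apply/radical_sub/add_principal_sub.
have Sx j : (j < d)%N -> S (x j).
  apply: (curve_eq_vanish hS radS) => [|i /JF /JS //].
  by apply/radical_sub/add_principal_gen.
apply: (binomial_vanishing hS Sx) => // [ltp|eqp].
  by apply: (torus_eq_vanish_lt hS radS d_gt0 ltp Sx); apply/JS/JG.
by apply: (torus_eq_vanish_eq radS d_gt0 eqp); apply: JS.
Qed.

End CompleteIntersection.

(** * The chain of partial parametrizations *)

Section Height.
Variables (K : fieldType) (n : nat).
Implicit Types Q : {mpoly K[n]} -> Prop.

(** Only the top prime of the chain is replaced; the last inclusion stays strict because [Q']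
    contains [Q]. *)
Lemma prime_chain_to_sup Q Q' d : (0 < d)%N -> prime_ideal Q' -> (forall f, Q f -> Q' f) ->
  prime_chain_to Q d -> prime_chain_to Q' d.
Proof.
case: d => // d _ primeQ' QQ' [R [primeR [strictR RQ]]].
exists (fun i => if (i <= d)%N then R i else Q'); split=> [i _|].
  by case: (leqP i d) => // id; apply: primeR; apply: leqW.
split=> [i|f]; last by rewrite ltnn.
rewrite ltnS => id; rewrite id; have [sub [f [Rf Nf]]] := strictR i id.
case: (ltnP i d) => di; first by split=> //; exists f.
have RQ' g : R i.+1 g -> Q' g.
  have -> : i = d by apply/eqP; rewrite eqn_leq id.
  by move=> /RQ/QQ'.
by split=> [g /sub/RQ'//|]; exists f; split=> //; apply: RQ'.
Qed.

Lemma monker_lin_indep k (B : 'I_n -> 'X_{1..k}) (T : finType) (mu : T -> 'X_{1..n}) :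
  injective (fun t => mdegree B (mu t)) -> lin_indep_mod (monker (K := K) B) (fun t => 'X_[mu t]).
Proof.
move=> injmu a; rewrite /monker raddf_sum /= => a0 t.
have := congr1 (mcoeff (mdegree B (mu t))) a0.
rewrite raddf_sum mcoeff0 /= (bigD1 t) //= mmapZ monmapX mcoeffCM mcoeffX eqxx mulr1.
rewrite big1 ?addr0 // => s /negPf st.
by rewrite mmapZ monmapX mcoeffCM mcoeffX (inj_eq injmu) st mulr0.
Qed.

Lemma mdegree_comp k (B : 'I_n -> 'X_{1..k}) l (C : 'I_k -> 'X_{1..l}) u :
  mdegree C (mdegree B u) = mdegree (fun j => mdegree C (B j)) u.
Proof.
apply/mnmP => i; rewrite /mdegree !mnm_sumE.
under eq_bigr do rewrite mulmnE mnm_sumE big_distrr.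
rewrite exchange_big; apply: eq_bigr => j _ /=; rewrite mulmnE mnm_sumE big_distrl.
by apply: eq_bigr => h _ /=; rewrite !mulmnE mulnA.
Qed.

Lemma mdegree_id (B : 'I_n -> 'X_{1..n}) e (u : 'X_{1..n}) :
  (forall j, u j != 0%N -> B j = (U_(j) *+ e)%MM) -> mdegree B u = (u *+ e)%MM.
Proof.
move=> BE; apply/mnmP => i; rewrite mulmnE /mdegree mnm_sumE.
have E j : (B j *+ u j)%MM i = ((j == i) * (u j * e))%N.
  rewrite mulmnE; have [->|/BE ->] := eqVneq (u j) 0%N; first by rewrite !muln0.
  by rewrite mulmnE mnm1E -mulnA [(e * _)%N]mulnC.
rewrite (bigD1 i) //= E eqxx mul1n big1 ?addn0 // => j /negPf ji.
by rewrite E ji.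
Qed.

End Height.

(** * The matrix: parametrization, height and fibers *)

Section Matrix.
Variables (K : fieldType) (m d : nat) (c : nat -> nat).
Hypotheses (m_gt0 : (0 < m)%N) (d_gt1 : (1 < d)%N) (c1_gt0 : (0 < c 1%N)%N).
Hypothesis dc2 : (d * c 2%N <= c 1%N)%N.

(** For [j <= d], column [j] of the matrix with its rows placed in coordinates
    [0, d + 1, ..., m + d - 1]. Coordinates [1, ..., d] are kept for the variables that are still
    free in a partial parametrization. *)
Definition column (j : nat) : 'X_{1..m + d} :=
  [multinom (if l == 0%N :> nat then c 1%N - j * c 2%N
             else if (d < l)%N then j * c (l - d).+2 else 0)%N | l < m + d].

(* Interpolates between the injective map [x_j |-> x_j] (up to powers) for
   [i = 0] and the toric parametrization for [i = d]. *)
Definition partial_columns i (j : 'I_(m + d)) : 'X_{1..m + d} :=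
  if (j <= i)%N then column j else if (d < j)%N then (U_(j) *+ c 1%N)%MM else U_(j)%MM.

Let md_gt0 : (0 < m + d)%N. Proof. by rewrite addn_gt0 m_gt0. Qed.

Let dmd : (d < m + d)%N. Proof. by rewrite -[X in (X < _)%N]add0n ltn_add2r. Qed.

Let is_param (l : 'I_(m + d)) := (l == 0%N :> nat) || (d < l)%N.

Lemma column_param j (l : 'I_(m + d)) : ~~ is_param l -> column j l = 0%N.
Proof. by rewrite /is_param mnmE negb_or => /andP[/negPf -> /negPf ->]. Qed.

Lemma partial_columns_param i (l : 'I_(m + d)) : (i <= d)%N -> is_param l ->
  partial_columns i l = (U_(l) *+ c 1%N)%MM.
Proof.
rewrite /partial_columns => id /orP[/eqP l0|dl]; last first.
  by rewrite leqNgt (leq_ltn_trans id dl) dl.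
rewrite l0 /=; apply/mnmP => h; rewrite mnmE mulmnE mnm1E -val_eqE /= l0 eq_sym.
by case: eqP => _; rewrite ?mul0n ?subn0 ?mul1n ?if_same.
Qed.

Lemma mdegree_param i (u : 'X_{1..m + d}) : (i <= d)%N ->
  (forall l, ~~ is_param l -> u l = 0%N) -> mdegree (partial_columns i) u = (u *+ c 1%N)%MM.
Proof.
move=> id u0; apply: mdegree_id => l ul; apply: partial_columns_param => //.
by apply: contraNT ul => /u0 ->.
Qed.

(** Stage [i + 1] is stage [i] followed by the substitution [C] of [x_(i+1)] by its column; the
    other images at stage [i] do not involve [x_(i+1)]. *)
Lemma partial_columns_succ i u v : (i < d)%N ->
  mdegree (partial_columns i) u = mdegree (partial_columns i) v ->
  mdegree (partial_columns i.+1) u = mdegree (partial_columns i.+1) v.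
Proof.
move=> id Euv.
pose C (l : 'I_(m + d)) := if l == i.+1 :> nat then column i.+1 else U_(l)%MM.
have CE w : mdegree (partial_columns i.+1) w = mdegree C (mdegree (partial_columns i) w).
  rewrite mdegree_comp; apply: eq_bigr => j _; congr (_ *+ _)%MM.
  have fixC (t : 'X_{1..m + d}) : (forall l : 'I_(m + d), l = i.+1 :> nat -> t l = 0%N) ->
      mdegree C t = t.
    move=> t0; rewrite (mdegree_id (e := 1)) ?mulm1n // => l tl.
    by rewrite /C mulm1n; case: eqP => // /t0 t0'; rewrite t0' in tl.
  rewrite /partial_columns; case: (ltngtP j i.+1) => ji.
  - rewrite -ltnS ji fixC // => l li; apply: column_param.
    by rewrite /is_param li /= -leqNgt.
  - have -> : (j <= i)%N = false by lia.
    case: ifP => _; rewrite fixC // => l li.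
      by rewrite mulmnE mnm1E -val_eqE /= li; case: eqP ji => // ->; rewrite ltnn.
    by rewrite mnm1E -val_eqE /= li; case: eqP ji => // ->; rewrite ltnn.
  - rewrite ji ltnn ltnNge id /= /mdegree (bigD1 j) //= mnm1E eqxx mulm1n /C ji eqxx.
    rewrite big1 ?addm0 // => l /negPf lj; rewrite mnm1E [j == l]eq_sym lj; exact: mulm0n.
by rewrite !CE Euv.
Qed.

Lemma monker_chain : prime_chain_to (monker (K := K) (partial_columns d)) d.
Proof.
exists (fun i => monker (partial_columns i)); split=> [i _|]; first exact: monker_prime.
split=> // i id; split.
  apply: monker_sub; first by case: (monker_prime K (partial_columns i.+1)).
  by move=> u v /(partial_columns_succ id)/monker_binomial.
have imd : (i.+1 < m + d)%N by apply: leq_ltn_trans dmd.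
pose j : 'I_(m + d) := Ordinal imd.
(* Parameter variables map to their [c_1]-th powers, so both monomials have the same image at stage
   [i + 1], while at stage [i] the variable [x_(i+1)] is still free. *)
exists ('X_[U_(j) *+ c 1%N] - 'X_[column i.+1]); rewrite !monker_binomial.
have colE e : (e <= d)%N -> mdegree (partial_columns e) (column i.+1) = (column i.+1 *+ c 1%N)%MM.
  by move=> ed; apply: mdegree_param => // l; apply: column_param.
have powE e : mdegree (partial_columns e) (U_(j) *+ c 1%N)%MM = (partial_columns e j *+ c 1%N)%MM.
  rewrite /mdegree (bigD1 j) //= mulmnE mnm1E eqxx mul1n big1 ?addm0 // => l /negPf lj.
  by rewrite mulmnE mnm1E eq_sym lj mul0n mulm0n.
rewrite !powE !colE ?(ltnW id) // /partial_columns /= leqnn ltnn.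
split=> // /mnmP/(_ j); rewrite !mulmnE (ltnNge d) id /= mnm1E eqxx column_param.
  by move/eqP; rewrite mul1n mul0n -leqn0 leqNgt c1_gt0.
by rewrite /is_param /= -leqNgt.
Qed.

Let row_ord_subproof (r : 'I_m) : ((if r == 0%N :> nat then 0 else d + r) < m + d)%N.
Proof. by case: ifP => // _; rewrite addnC ltn_add2r. Qed.
Let row_ord r := Ordinal (row_ord_subproof r).

Let row_ord_inj : injective row_ord.
Proof.
move=> r s /(congr1 val) /=; case: eqP => r0; case: eqP => s0 rs; apply: val_inj => /=; lia.
Qed.

Let row_ord_param r : is_param (row_ord r).
Proof. by rewrite /is_param /=; case: ifP => // r0; apply/orP; right; lia. Qed.

Let is_param_row l : is_param l -> exists r, l = row_ord r.
Proof.
rewrite /is_param => /orP[/eqP l0|dl]; first by exists (Ordinal m_gt0); apply: val_inj.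
have lm : (l - d < m)%N by have := ltn_ord l; lia.
by exists (Ordinal lm); apply: val_inj => /=; case: eqP; lia.
Qed.

Lemma McdE r j : Mcd m d c r j = (partial_columns d j (row_ord r))%:Z.
Proof.
rewrite /Mcd mxE /partial_columns; case: (leqP j d) => jd.
  rewrite mnmE /=; case: (eqVneq (r : nat) 0%N) => [r0|r0] /=.
    rewrite subzn //; apply: leq_trans dc2; rewrite leq_mul2r jd orbT //.
  have r_gt0 : (0 < r)%N by rewrite lt0n.
  by rewrite ifF ?ifT ?addKn //; [lia|apply/eqP; lia].
rewrite mulmnE mnm1E -val_eqE /=.
case: (eqVneq (r : nat) (j - d)%N) => rj.
  by rewrite ifF; [rewrite rj subnKC ?eqxx ?mul1n // ltnW|apply/eqP; lia].
rewrite (_ : (_ == _) = false) //; apply/eqP; case: eqP => r0; first by lia.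
by move=> jE; rewrite jE addKn eqxx in rj.
Qed.

Lemma mdegree_not_param l (u : 'X_{1..m + d}) : ~~ is_param l ->
  mdegree (partial_columns d) u l = 0%N.
Proof.
move=> pl; rewrite /mdegree mnm_sumE big1 // => j _; rewrite mulmnE /partial_columns.
case: leqP => dj; first by rewrite column_param.
rewrite mulmnE mnm1E; case: eqP => // jl.
by move: pl; rewrite /is_param -jl dj orbT.
Qed.

Lemma toric_partial_columns (f : {mpoly K[m + d]}) :
  toric_ideal (Mcd m d c) f <-> monker (partial_columns d) f.
Proof.
apply: toric_monker => u v.
have ME (t : 'X_{1..m + d}) r : \sum_(j < m + d) Mcd m d c r j * (t j)%:Z
    = (mdegree (partial_columns d) t (row_ord r))%:Z.
  rewrite /mdegree mnm_sumE -[RHS]natz natr_sum; apply: eq_bigr => j _.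
  by rewrite McdE mulmnE natz PoszM.
split=> [Euv r|Euv]; first by rewrite !ME Euv.
apply/mnmP => l; case: (boolP (is_param l)) => pl.
  by have [r ->] := is_param_row pl; have := Euv r; rewrite !ME => -[].
by rewrite !mdegree_not_param.
Qed.

Lemma poly_indep_mod_monker :
  poly_indep_mod (monker (K := K) (partial_columns d)) m.
Proof.
(* Monomials in the [m] parameter variables with exponents below [D] have distinct images and size
   at most [m * D + 1]. *)
exists m.+1 => D D_gt0.
pose mu (t : {ffun 'I_m -> 'I_D}) : 'X_{1..m + d} := (\sum_r U_(row_ord r) *+ t r)%MM.
have muE t r : mu t (row_ord r) = t r :> nat.
  rewrite /mu mnm_sumE (bigD1 r) //= mulmnE mnm1E eqxx mul1n big1 ?addn0 // => s /negPf sr.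
  by rewrite mulmnE mnm1E (inj_eq row_ord_inj) sr.
have mu0 t l : ~~ is_param l -> mu t l = 0%N.
  move=> pl; rewrite /mu mnm_sumE big1 // => r _; rewrite mulmnE mnm1E.
  by case: eqP => // rl; rewrite -rl row_ord_param in pl.
exists {ffun 'I_m -> 'I_D}, (fun t => 'X_[mu t]); split.
- by rewrite card_ffun !card_ord.
- move=> t; rewrite msizeX /mu mdeg_sum mulSn -addn1 addnC leq_add //.
  rewrite -[X in (_ <= X * _)%N]card_ord -sum_nat_const leq_sum // => r _.
  by rewrite mdegMn mdeg1 mul1n ltnW.
apply: monker_lin_indep => t s; rewrite !(mdegree_param (leqnn d) (mu0 _)) => Ets.
apply/ffunP => r; apply/val_inj; rewrite /= -!muE; apply/eqP.
by rewrite -(eqn_pmul2r c1_gt0) -!mulmnE Ets.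
Qed.

(** The toric ideal is itself prime, so it is its own witness: the explicit chain has length [d],
    the growth bound gives [m + k <= m + d], and larger primes inherit the chain. *)
Lemma toric_height : ideal_height (toric_ideal (K := K) (Mcd m d c)) d.
Proof.
have d_gt0 : (0 < d)%N by apply: ltnW.
split.
  exists (monker (partial_columns d)); split; first exact: monker_prime.
  split=> [f /toric_partial_columns //|]; split; first exact: monker_chain.
  by move=> k /prime_chain_leq/(_ poly_indep_mod_monker); rewrite leq_add2l.
move=> Q primeQ IQ; apply: (prime_chain_to_sup d_gt0 primeQ _ monker_chain) => f.
by move=> /toric_partial_columns/IQ.
Qed.

(** Coordinate [0] gives the first equation of [congruent], coordinates above [d] the others, and
    coordinates [1, ..., d] are zero. *)
Lemma congruent_partial_columns u v :
  mdegree (partial_columns d) u = mdegree (partial_columns d) v <->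
  congruent (c 1%N) (c 2%N) (fun r => c r.+2) u v.
Proof.
have low (t : 'X_{1..m + d}) (l : 'I_(m + d)) : l = 0%N :> nat ->
    (c 1%N * total_deg t = mdegree (partial_columns d) t l + c 2%N * weight t)%N.
  move=> l0; rewrite /total_deg /weight /mdegree mnm_sumE !big_distrr /=.
  rewrite [X in (_ = X + _)%N](bigID (fun j : 'I_(m + d) => (j <= d)%N)) /=.
  rewrite [X in (_ + X + _)%N]big1 ?addn0 => [|j jd].
    rewrite -big_split; apply: eq_bigr => j jd /=.
    rewrite mulmnE /partial_columns jd mnmE l0 /=.
    have : (j * c 2%N <= c 1%N)%N by apply: leq_trans dc2; rewrite leq_mul2r jd orbT.
    by move=> jc; rewrite -{1}(subnK jc) mulnDl; congr addn; lia.
  rewrite mulmnE partial_columns_param ?mulmnE ?mnm1E -?val_eqE //=.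
    by rewrite l0; case: eqP jd => // ->.
  by rewrite /is_param ltnNge jd orbT.
have high (t : 'X_{1..m + d}) (l : 'I_(m + d)) : (d < l)%N ->
    (mdegree (partial_columns d) t l = c (l - d).+2 * weight t + c 1%N * t l)%N.
  move=> dl; rewrite /weight /mdegree mnm_sumE big_distrr /=.
  rewrite (bigID (fun j : 'I_(m + d) => (j <= d)%N)) /=; congr addn.
    apply: eq_bigr => j jd; rewrite mulmnE /partial_columns jd mnmE dl ifF; first by lia.
    by apply/eqP; lia.
  rewrite (bigD1 l) -?ltnNge //= big1 ?addn0 => [|j /andP[jd /negPf jl]].
    by rewrite mulmnE partial_columns_param /is_param ?dl ?orbT // mulmnE mnm1E eqxx mul1n.
  by rewrite mulmnE partial_columns_param /is_param ?ltnNge ?jd ?orbT // mulmnE mnm1E jl.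
split=> [Euv|[E0 Ej]].
  split=> [|j dj]; last by rewrite -!high // Euv.
  have := low u (Ordinal md_gt0) erefl; have := low v (Ordinal md_gt0) erefl.
  by rewrite Euv; lia.
apply/mnmP => l; case: (ltnP d l) => [dl|]; first by rewrite !high // Ej.
case: (posnP l) => [l0 _|l_gt0 ld].
  by have := low u l l0; have := low v l l0; lia.
have pl : ~~ is_param l by rewrite /is_param negb_or -lt0n l_gt0 -leqNgt.
by rewrite !mdegree_not_param.
Qed.

End Matrix.

Theorem theorem6p1 (K : fieldType) (m d : nat) (c : nat -> nat)
  (hm : (1 <= m)%N) (hd : (1 < d)%N) (hc1 : (0 < c 1%N)%N)
  (hc : (d * c 2%N <= c 1%N)%N)
  (hcol : forall j : 'I_(m + d), exists r : 'I_m, Mcd m d c r j != 0) :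
  ideal_height (@toric_ideal K _ _ (Mcd m d c)) d /\
  set_theoretic_complete_intersection (@toric_ideal K _ _ (Mcd m d c)).
Proof.
have hI := toric_height K hm hd hc1 hc; split=> //.
pose g := (\big[gcdn/0]_(1 <= i < m.+2) c i)%N.
have g_dvd i : (0 < i < m.+2)%N -> (g %| c i)%N.
  move=> hi; rewrite /g (big_rem i) ?mem_index_iota //=; exact: dvdn_gcdl.
have g1 : (g %| c 1%N)%N by apply: g_dvd.
have g2 : (g %| c 2%N)%N by apply: g_dvd; lia.
have g_gt0 : (0 < g)%N by apply: dvdn_gt0 g1.
pose p := (c 1%N %/ g)%N; pose q := (c 2%N %/ g)%N; pose w r := (c r.+2 %/ g)%N.
have p_gt0 : (0 < p)%N by rewrite divn_gt0 // dvdn_leq.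
have dqp : (d * q <= p)%N by rewrite leq_divRL // -mulnA divnK.
(* The assumptions say that [c_1] divides every [c_i e], hence their gcd [g e]; dividing by [g]
   gives the claim. *)
have p_dvd e : (p %| q * e)%N -> (forall r, (0 < r < m)%N -> (p %| w r * e)%N) -> (p %| e)%N.
  move=> pq pw; rewrite -(dvdn_pmul2l g_gt0) /p mulnC divnK // {1}/g.
  rewrite (big_morph (fun a => a * e)%N (fun a b => muln_gcdl a b e) (mul0n e)).
  rewrite big_nat; elim/big_ind: _ => [|a b pa pb|i hi]; rewrite ?dvdn0 ?dvdn_gcd ?pa //.
  suff : (p %| c i %/ g * e)%N.
    by rewrite -(dvdn_pmul2r g_gt0) mulnAC /p !divnK // g_dvd.
  case: i hi => [//|[_|[_ //|r hr]]]; first exact: dvdn_mulr.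
  by apply: pw.
have hB (u v : 'X_{1..m + d}) : mdegree (@partial_columns m d c d) u
    = mdegree (@partial_columns m d c d) v <-> congruent p q w u v.
  rewrite congruent_partial_columns // /congruent; split=> -[E0 Ej].
    split=> [|j dj]; apply/eqP; rewrite -(eqn_pmul2l g_gt0) !mulnDr !mulnA ![(g * _)%N]mulnC.
      by rewrite !divnK //; apply/eqP.
    rewrite !divnK //; first by apply/eqP; apply: Ej.
    by apply: g_dvd; have := ltn_ord j; lia.
  have cE i : (0 < i < m.+2)%N -> c i = (g * (c i %/ g))%N by move=> /g_dvd gi; rewrite mulnC divnK.
  split=> [|j dj]; first by rewrite (cE 1%N) // (cE 2%N) ?ltnS // -!mulnA -!mulnDr E0.
  rewrite (cE 1%N) // (cE (j - d).+2); first by rewrite -!mulnA -!mulnDr Ej.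
  by have := ltn_ord j; lia.
have [gs gsP] := monker_set_theoretic K hd hm p_gt0 dqp p_dvd hB.
exists d, gs; split=> // f.
by rewrite toric_partial_columns.
Qed.
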